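(* For a separable metrizable space $M$, $\mathcal{K}(\mathbb{Q})\ge_T\mathcal{K}(M)$ if and only if $M$ is a compact-covering image of a co-analytic set.
   Context: For directed sets $P,Q$, write $P\ge_T Q$ if there is a map $\phi:P\to Q$ carrying every cofinal subset of $P$ to a cofinal subset of $Q$. For a space $X$, $\mathcal{K}(X)$ is the set of compact subsets of $X$ ordered by inclusion. $\mathbb{Q}$ is the space of rationals. A map $f:X\to Y$ is compact-covering if it is continuous and for every compact $L\subseteq Y$ there is a compact $K\subseteq X$ with $f(K)\supseteq L$; then $Y$ is called a compact-covering image of $X$. A separable metrizable space is analytic if it is a continuous image of a Polish space, and co-analytic if it is (homeomorphic to) the complement in a compact metric space of an analytic set. *)

(* Defs.v *)
From HB Require Import structures.
From mathcomp Require Import all_boot all_order all_algebra.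
From mathcomp Require Import all_classical all_reals all_analysis.

Set Implicit Arguments.
Unset Strict Implicit.
Unset Printing Implicit Defensive.

Import Order.TTheory GRing.Theory Num.Theory.
Import numFieldNormedType.Exports.

Local Open Scope classical_set_scope.
Local Open Scope ring_scope.

Record directedSet := DirectedSet {
  dcarrier :> Type;
  dle : dcarrier -> dcarrier -> Prop;
  dle_refl : forall x, dle x x;
  dle_trans : forall y x z, dle x y -> dle y z -> dle x z;
  dle_anti : forall x y, dle x y -> dle y x -> x = y;
  dle_ub : forall x y, exists z, dle x z /\ dle y z
}.

Definition cofinal (P : directedSet) (C : set P) : Prop :=
  forall x : P, exists2 c, C c & dle x c.

Definition tukey_ge (P Q : directedSet) : Prop :=
  exists phi : P -> Q, forall C : set P, cofinal C -> cofinal (phi @` C).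

Section compact_subsets.
Variable X : topologicalType.

Definition compact_subset : Type := {K : set X | compact K}.

Definition csub_le (K L : compact_subset) : Prop := sval K `<=` sval L.

Lemma csub_le_refl K : csub_le K K.
Proof. by []. Qed.

Lemma csub_le_trans L K N : csub_le K L -> csub_le L N -> csub_le K N.
Proof. exact: subset_trans. Qed.

Lemma csub_le_anti K L : csub_le K L -> csub_le L K -> K = L.
Proof. by move=> KL LK; apply: eq_sig_hprop => //; apply/seteqP. Qed.

Lemma csub_le_ub K L : exists N, csub_le K N /\ csub_le L N.
Proof.
exists (exist _ (sval K `|` sval L) (compactU (svalP K) (svalP L))).
by split; [exact: subsetUl | exact: subsetUr].
Qed.

(* The empty set is compact, so it is an element of [Kc X]. *)
Definition Kc : directedSet :=
  DirectedSet csub_le_refl csub_le_trans csub_le_anti csub_le_ub.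

End compact_subsets.

Definition homeomorphic (X Y : topologicalType) : Prop :=
  exists (f : X -> Y) (g : Y -> X),
    [/\ cancel f g, cancel g f, continuous f & continuous g].

Definition separable (X : topologicalType) : Prop :=
  exists2 D : set X, countable D & dense D.

Definition metrizable (R : realType) (X : topologicalType) : Prop :=
  exists Y : metricType R, homeomorphic X Y.

(* The library's complete spaces are pointed; here the empty space is
   allowed, so that the empty set is Polish and hence analytic. *)
Definition complete_metric (R : realType) (Y : metricType R) : Prop :=
  forall F : set_system Y, ProperFilter F -> cauchy F -> exists y : Y, F --> y.

Definition polish (R : realType) (X : topologicalType) : Prop :=
  separable X /\
  exists2 Y : metricType R, complete_metric Y & homeomorphic X Y.

Definition separable_metrizable (R : realType) (X : topologicalType) : Prop :=
  separable X /\ metrizable R X.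

Definition analytic (R : realType) (X : topologicalType) : Prop :=
  separable_metrizable R X /\
  exists (P : topologicalType) (f : P -> X),
    [/\ polish R P, continuous f & range f = setT].

(* A subset of [K], coerced to a type, carries the subspace topology. *)
Definition coanalytic (R : realType) (X : topologicalType) : Prop :=
  separable_metrizable R X /\
  exists (K : metricType R) (A : set K),
    [/\ compact [set: K], analytic R A & homeomorphic X (~` A)].

(* Taking L to be a singleton shows that such an f is onto. *)
Definition compact_covering (X Y : topologicalType) (f : X -> Y) : Prop :=
  continuous f /\
  forall L : set Y, compact L -> exists2 K : set X, compact K & L `<=` f @` K.

Definition compact_covering_image (X Y : topologicalType) : Prop :=
  exists f : X -> Y, compact_covering f.

(* The regular structure [rat^o] carries the topology of the distance
   `|x - y|, i.e. the usual topology of the rationals. *)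
Definition rationals : topologicalType := rat^o.

(* Main.v *)
Require Import Defs.
From HB Require Import structures.
From mathcomp Require Import all_boot all_order all_algebra.
From mathcomp Require Import all_classical all_reals all_analysis.
From mathcomp Require Import zify ring lra.

Set Implicit Arguments.
Unset Strict Implicit.
Unset Printing Implicit Defensive.

Import Order.TTheory GRing.Theory Num.Theory.
Import numFieldNormedType.Exports.

Local Open Scope classical_set_scope.
Local Open Scope ring_scope.

(**
From right to left it suffices to map [K(Q)] onto a cofinal part of [K(X)] for
[X] the complement in a compact metric [K] of [A = f(Y)], with [Y] Polish. Fix a
Souslin scheme on [Y] by balls of radius [1/(k+1)] around a countable dense set,
and let [U_s] be the [1/(|s|+1)]-neighbourhood of the image of the piece indexed
by [s]; then [x] is in [A] iff [x] lies in all [U_(a|n)], equivalently in all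
their closures, for some [a]. Attach rationals [z_s] to finite sequences so that
[z_(a|n)] tends to an irrational for every [a], whereas [{z_s : s in T}] is
compact for every well-founded tree [T]. Then
[C |-> {x : forall s, x in U_s -> z_s in C}] is monotone from [K(Q)] to [K(X)];
a compact [L] is below the image of [{z_s : U_s meets L}].

From left to right, a Tukey quotient yields a monotone [D : K(Q) -> K(M)] with
cofinal image. Embed [Q] in a Cantor space by a countable clopen base, code
[C] in [K(Q)] by the set [S] of cylinders meeting it and [x] in [M] by a subset
[t] of a countable base. The closure, in a Cantor space, of the set of codes
[(S, t)] of pairs with [x] in [D(C)], restricted to those [S] all of whose
branches belong to [Q], is co-analytic. Each of its points still codes some [x]:
if codes of [(C_n, x_n)] converge to it, the union of the [C_n] and of the set
coded by the limit is a compact [C'], so all [x_n] lie in the compact [D(C')].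
Decoding is continuous, and it is compact-covering because [{C} * L] is coded by
a compact set whenever [L] is contained in [D(C)].
*)

(** * Tukey order and compact-covering maps *)

Lemma tukey_ge_trans (P Q S : directedSet) :
  tukey_ge P Q -> tukey_ge Q S -> tukey_ge P S.
Proof.
move=> [f fP] [g gP]; exists (g \o f) => C cC.
by rewrite -image_comp; apply/gP/fP.
Qed.

Lemma tukey_ge_monotone (P Q : directedSet) (f : P -> Q) :
  (forall x y, dle x y -> dle (f x) (f y)) ->
  (forall z, exists x, dle z (f x)) -> tukey_ge P Q.
Proof.
move=> fmono fcof; exists f => C cC z.
have [x zx] := fcof z; have [c Cc xc] := cC x.
by exists (f c); [exists c|exact: dle_trans (fmono _ _ xc)].
Qed.

Lemma tukey_ge_compact_covering (X Y : topologicalType) :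
  compact_covering_image X Y -> tukey_ge (Kc X) (Kc Y).
Proof.
move=> [f [cf fcov]].
have cim (K : set X) : compact K -> compact (f @` K).
  by apply: continuous_compact; exact: continuous_subspaceT.
pose phi (K : Kc X) : Kc Y := exist _ (f @` sval K) (cim _ (svalP K)).
apply: (@tukey_ge_monotone _ _ phi) => [K L KL|[L Lc]].
  exact: image_subset.
by have [K Kc LK] := fcov L Lc; exists (exist _ K Kc).
Qed.

Lemma homeomorphic_compact_covering_image (X Y : topologicalType) :
  homeomorphic X Y -> compact_covering_image Y X.
Proof.
move=> [f [g [fK gK cf cg]]]; exists g; split=> // L Lc.
exists (f @` L).
  by apply: continuous_compact => //; exact: continuous_subspaceT.
by move=> x Lx; exists (f x) => //; exists x.
Qed.

Lemma homeomorphic_refl (X : topologicalType) : homeomorphic X X.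
Proof. by exists id, id; split=> // x; exact: cvg_id. Qed.

(** * Subspaces: neighbourhoods, compact sets and the restricted metric *)

Lemma nbhs_set_typeP (X : topologicalType) (A : set X) (x : A) (U : set A) :
  nbhs x U <-> exists2 V, nbhs (set_val x) V & set_val @^-1` V `<=` U.
Proof.
split=> [[_ [[V oV <-] Vx] VU]|[V Vx VU]].
  by exists V => //; exact: open_nbhs_nbhs.
apply: (filterS VU).
by apply: (@initial_continuous A X set_val x).
Qed.

Lemma compact_set_type (X : topologicalType) (A B : set X) :
  compact B -> B `<=` A -> compact (set_val @^-1` B : set A).
Proof.
move=> Bc BA F FF FB.
have [p [Bp clp]] := Bc (set_val @ F) _ FB.
exists (exist _ p (mem_set (BA _ Bp))); split=> // U V FU.
move=> /nbhs_set_typeP[W Wp WV].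
have [_ [[q Uq <-] Wq]] : (set_val @` U) `&` W !=set0.
  apply: clp => //; apply: (@filterS _ F _ U) => // q Uq.
  by exists q.
by exists q; split=> //; exact: WV.
Qed.

Section set_type_metric.
Variables (R : realType) (Y : metricType R) (A : set Y).

Let dist (x y : A) : R := mdist (set_val x) (set_val y).

Let dist_ge0 x y : 0 <= dist x y.
Proof. exact: mdist_ge0. Qed.

Let dist_positivity x y : dist x y = 0 -> x = y.
Proof. by move=> /mdist_positivity xy; exact: val_inj. Qed.

Let ball_dist (x : A) d : ball x d = [set y | dist x y < d].
Proof.
by rewrite -initial_ballE ballEmdist.
Qed.

HB.instance Definition _ :=
  PseudoMetric_isMetric.Build R (A : Type) dist_ge0 dist_positivity ball_dist.

End set_type_metric.

(** * Metric spaces of functions on a countable set *)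

(* Functions on a countable index set, at distance [1 / (m + 1)] when [m] is
   the least code of an index at which they differ. *)
Definition fsp (R : realType) (I : countType) (T : choiceType) : Type := I -> T.

Section fsp_metric.
Variables (R : realType) (I : countType) (T : choiceType).
Local Notation F := (fsp R I T).

HB.instance Definition _ := gen_eqMixin F.
HB.instance Definition _ := gen_choiceMixin F.

Definition agree n (x y : F) := forall i, (pickle i < n)%N -> x i = y i.

Lemma agreeS m n x y : (m <= n)%N -> agree n x y -> agree m x y.
Proof. by move=> mn xy i im; apply: xy; exact: leq_trans mn. Qed.

Definition fdist (x y : F) : R :=
  if pselect (exists n, `[< ~ agree n.+1 x y >]) is left e
  then (ex_minn e).+1%:R^-1 else 0.

(** The metric axioms are all read off from this: agreement up to a bound is an equivalence
    relation, and nonzero distances are exactly of the form 1/(m+1). *)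
Lemma fdist_lt n x y : fdist x y < n.+1%:R^-1 <-> agree n.+1 x y.
Proof.
rewrite /fdist; case: pselect => [e|ne]; last first.
  rewrite invr_gt0 ltr0Sn; split=> // _; apply: contrapT => nxy.
  by apply: ne; exists n; apply/asboolP.
case: ex_minnP => m /asboolP nxy minm.
rewrite ltf_pV2 ?posrE ?ltr0Sn// ltr_nat ltnS; split=> [nm|xy].
  apply: contrapT => /asboolP/minm; rewrite leqNgt.
  by rewrite nm.
rewrite ltnNge; apply/negP => mn; apply: nxy.
exact: agreeS xy.
Qed.

Lemma fdist_val x y : fdist x y = 0 \/ exists m, fdist x y = m.+1%:R^-1.
Proof.
rewrite /fdist; case: pselect => [e|ne]; last by left.
by right; eexists.
Qed.

Lemma fdist_ge0 x y : 0 <= fdist x y.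
Proof. by have [->|[m ->]] := fdist_val x y. Qed.

Let fdistxx x : fdist x x = 0.
Proof.
have [//|[m xx]] := fdist_val x x.
by have /fdist_lt : agree m.+1 x x by []; rewrite xx ltxx.
Qed.

Let fdist_positivity x y : fdist x y = 0 -> x = y.
Proof.
move=> xy; apply/funext => i.
have /fdist_lt : fdist x y < (pickle i).+1%:R^-1 by rewrite xy invr_gt0.
exact.
Qed.

Let fdist_sym x y : fdist x y = fdist y x.
Proof.
have le a b : fdist a b <= fdist b a.
  have [->|[m abm]] := fdist_val a b; first exact: fdist_ge0.
  rewrite leNgt abm; apply/negP => /fdist_lt ba.
  have /fdist_lt : agree m.+1 a b by move=> i im; rewrite ba.
  by rewrite abm ltxx.
by apply/eqP; rewrite eq_le !le.
Qed.

Let fdist_triangle y x z : fdist x z <= fdist x y + fdist y z.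
Proof.
have [->|[m xzm]] := fdist_val x z; first by rewrite addr_ge0 ?fdist_ge0.
rewrite leNgt; apply/negP => lt_xz.
have /fdist_lt : agree m.+1 x z.
  move=> i im.
  have /fdist_lt -> // : fdist x y < m.+1%:R^-1.
    by rewrite -xzm (le_lt_trans _ lt_xz)// lerDl fdist_ge0.
  have /fdist_lt -> // : fdist y z < m.+1%:R^-1.
  by rewrite -xzm (le_lt_trans _ lt_xz)// lerDr fdist_ge0.
by rewrite xzm ltxx.
Qed.

HB.instance Definition _ := @isMetric.Build R F fdist
  fdistxx fdist_positivity fdist_sym fdist_triangle.

Lemma ball_fspE n (x : F) : ball x n.+1%:R^-1 = agree n.+1 x.
Proof.
rewrite ballEmdist; apply/seteqP; split=> y /=; first by move/fdist_lt.
by move=> ?; apply/fdist_lt.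
Qed.

Lemma nbhs_fspP (x : F) (U : set F) :
  nbhs x U <-> exists n, agree n x `<=` U.
Proof.
split=> [/nbhs_ballP[e /= e0 xU]|[n xU]].
  have [n] := ltr_add_invr e0; rewrite add0r => ne.
  by exists n.+1; rewrite -ball_fspE; apply: subset_trans xU; exact/le_ball/ltW.
apply/nbhs_ballP; exists n.+1%:R^-1; first by rewrite /= invr_gt0.
rewrite ball_fspE; apply: subset_trans xU => y.
exact: agreeS.
Qed.

End fsp_metric.

Section fsp_topology.
Variables (R : realType) (I : countType) (T : choiceType).
Local Notation F := (fsp R I T).

Lemma nbhs_agree n (x : F) : nbhs x (agree n x).
Proof. by apply/nbhs_fspP; exists n. Qed.

Lemma nbhs_coord i (x : F) : \forall y \near x, y i = x i.
Proof.
by apply: filterS (nbhs_agree (pickle i).+1 x) => y ->.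
Qed.

(** Locally constant coordinates suffice: [agree n] constrains only finitely many of them, at most
    one per code below [n]. *)
Lemma continuous_fsp (X : topologicalType) (f : X -> F) :
  (forall i x, \forall y \near x, f y i = f x i) -> continuous f.
Proof.
move=> fi x U /nbhs_fspP[n nU].
apply: (@filterS _ (nbhs x) _ (f @^-1` agree n (f x))); first by move=> y /nU.
elim: n {nU} => [|n IH]; first exact: filterE.
have [[i ni]|nex] := pselect (exists i : I, pickle i = n); last first.
  apply: filterS IH => y xy i; rewrite ltnS leq_eqVlt => /orP[/eqP ni|/xy //].
  by case: nex; exists i.
apply: filterS2 IH (fi i x) => y xy yi j.
rewrite ltnS leq_eqVlt => /orP[/eqP nj|/xy //].
suff -> : j = i by exact: esym.
by apply: (pcan_inj pickleK); rewrite nj.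
Qed.

Lemma closure_fsp (A : set F) (x : F) :
  closure A x -> exists y : nat -> F, forall n, A (y n) /\ agree n x (y n).
Proof.
move=> Ax; have /choice[y yP] : forall n, exists y, A y /\ agree n x y.
  by move=> n; have [y] := Ax _ (nbhs_agree n x); exists y.
by exists y.
Qed.

(** Basic clopen sets labelled by finite lists of constraints, so that for countable [T] the labels
    are countable and can index codes. *)
Definition cyl (l : seq (I * T)) (x : F) := forall p, p \in l -> x p.1 = p.2.

Lemma nbhs_cyl l (x : F) : cyl l x -> \forall y \near x, cyl l y.
Proof.
elim: l => [|p l IH] lx; first by apply: filterE => y p.
have lx' : cyl l x by move=> r rl; apply: lx; rewrite inE rl orbT.
apply: filterS2 (nbhs_coord p.1 x) (IH lx') => y yp ly r.
rewrite inE => /predU1P[->|/ly //].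
by rewrite yp; apply: lx; rewrite inE eqxx.
Qed.

Lemma cyl_agree n (x : F) :
  exists2 l, cyl l x & forall y, cyl l y -> agree n x y.
Proof.
exists [seq (i, x i) | i <- pmap (@unpickle I) (iota 0 n)].
  by move=> _ /mapP[i _ ->].
move=> y yl i ni; symmetry; apply: (yl (i, x i)).
apply: map_f; rewrite mem_pmap; apply/mapP.
by exists (pickle i); [rewrite mem_iota|rewrite pickleK].
Qed.

Lemma closed_fsp (A : set F) :
  (forall x, ~ A x -> \forall y \near x, ~ A y) -> closed A.
Proof.
move=> nA; rewrite -[A]setCK; apply: open_closedC; rewrite openE.
exact: nA.
Qed.

Lemma complete_closed_fsp (A : set F) : closed A -> complete_metric A.
Proof.
move=> Acl G GF Gcauchy.
have ex n : exists x : A, G [set y : A | agree n.+1 (set_val x) (set_val y)].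
  have [[P Q] [GP GQ] PQ] : filter_prod G G [set xy : A * A | ball xy.1 (n.+1%:R^-1 : R) xy.2].
    apply: Gcauchy; rewrite -entourage_ballE.
    by exists n.+1%:R^-1 => //=; exact: divr_gt0.
  have [x Px] := filter_ex GP; exists x.
  apply: filterS GQ => y Qy /=; rewrite -ball_fspE.
  by rewrite -[ball _ _ _]/(ball x (n.+1%:R^-1 : R) y); apply: (PQ (x, y)).
(* The limit is built diagonally: coordinate [i] is read off a point with which the filter agrees
   beyond the code of [i]. *)
pose c n := projT1 (cid (ex n)).
have cP n : G [set y : A | agree n.+1 (set_val (c n)) (set_val y)].
  exact: projT2 (cid (ex n)).
pose z : F := fun i => set_val (c (pickle i)) i.
have zP n : G [set y : A | agree n z (set_val y)].
  elim: n => [|n IH]; first exact: filterE.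
  apply: filterS2 IH (cP n) => y zy cy i.
  rewrite ltnS leq_eqVlt => /orP[/eqP ni|/zy //].
  by rewrite /z ni; apply: cy; rewrite ni.
have Az : A z.
  apply: Acl => V /nbhs_fspP[n nV].
  have [y zy] := filter_ex (zP n).
  by exists (set_val y); split; [exact/set_mem/valP|exact: nV].
exists (exist _ z (mem_set Az)) => V /nbhs_set_typeP[W /nbhs_fspP[n nW] WV].
by apply: filterS (zP n) => y zy; apply/WV/nW.
Qed.

End fsp_topology.

Lemma compact_fsp_bool (R : realType) (I : countType) :
  compact [set: fsp R I bool].
Proof.
pose P := prod_topology (fun _ : I => bool).
have cf : continuous (id : P -> fsp R I bool).
  apply: continuous_fsp => i x.
  apply: (@proj_continuous I (fun=> bool) i x [set b | b = x i]).
  exact: (discrete_set1 (x i)).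
have := @tychonoff I (fun=> bool) (fun=> setT) (fun=> bool_compact).
move=> /(@continuous_compact _ _ _ _ (continuous_subspaceT cf)).
by congr (compact _); apply/seteqP; split=> // x _; exists x.
Qed.

Lemma separable_fsp (R : realType) (I T : countType) (A : set (fsp R I T)) :
  separable A.
Proof.
pose B l : set A := set_val @^-1` cyl l.
pose pick l : set A :=
  if pselect (B l !=set0) is left e then [set projT1 (cid e)] else set0.
exists (\bigcup_l pick l).
  apply: bigcup_countable => [|l _]; first exact: countableP.
  by rewrite /pick; case: pselect => // e; exact: countable1.
move=> U [x Ux] oU.
have /nbhs_set_typeP[V /nbhs_fspP[n nV] VU] : nbhs x U by exact: open_nbhs_nbhs.
have [l xl ln] := cyl_agree n (set_val x).
have [y ly yl] : exists2 y, pick l y & B l y.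
  rewrite /pick; case: pselect => [e|[]]; last by exists x.
  by exists (projT1 (cid e)) => //; exact: projT2 (cid e).
by exists y; split; [exact/VU/nV/ln|exists l].
Qed.

(** * Rationals indexed by finite sequences *)

(* The state [(z, D)] is a partial sum [z] of unit fractions together with its
   last denominator [D]: appending [n] adds [1 / (D * (D + n + 1))].
   Denominators divide one another and grow so fast that infinite sums are
   irrational. *)
Definition rstep (p : rat * nat) (n : nat) : rat * nat :=
  let D := (p.2 * (p.2 + n.+1))%N in (p.1 + D%:R^-1, D).

Definition rnode (s : seq nat) : rat * nat := foldl rstep (0, 1%N) s.

Definition rsum (s : seq nat) : rationals := (rnode s).1.
Definition rden (s : seq nat) : nat := (rnode s).2.

Lemma rsum_rcons s n : rsum (rcons s n) = (rsum s + (rden (rcons s n))%:R^-1 : rat).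
Proof. by rewrite /rsum /rden /rnode foldl_rcons. Qed.

Lemma rden_rcons s n : rden (rcons s n) = (rden s * (rden s + n.+1))%N.
Proof. by rewrite /rden /rnode foldl_rcons. Qed.

Lemma rden_gt s : (size s < rden s)%N.
Proof.
elim/last_ind: s => [//|s n IH]; rewrite rden_rcons size_rcons.
by nia.
Qed.

Lemma rden_gt0 s : (0 < rden s)%N.
Proof. exact: leq_ltn_trans (rden_gt s). Qed.

Lemma rsum_nat s : exists k, (rsum s : rat) * (rden s)%:R = k%:R.
Proof.
elim/last_ind: s => [|s n [k IH]]; first by exists 0%N; rewrite mul0r.
exists (k * (rden s + n.+1) + 1)%N.
rewrite rsum_rcons mulrDl mulVf ?pnatr_eq0 -?lt0n ?rden_gt0//.
by rewrite rden_rcons natrD !natrM mulrA IH.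
Qed.

(** Sums grow along extensions while [rsum] plus 1/[rden] shrinks, as each new denominator is at
    least twice the old one. Hence all sums above [s] lie in an interval of length 1/[rden s]. *)
Lemma rsum_cat s t :
  (rsum s <= rsum (s ++ t) :> rat) /\
  ((rsum (s ++ t) : rat) + (rden (s ++ t))%:R^-1 <= rsum s + (rden s)%:R^-1).
Proof.
elim/last_ind: t => [|t n [IH1 IH2]]; first by rewrite cats0.
rewrite -rcons_cat rsum_rcons.
have D0 : (0 : rat) < (rden (s ++ t))%:R by rewrite ltr0n rden_gt0.
have y2 : ((rden (s ++ t) + n.+1)%:R^-1 : rat) <= 2^-1.
  rewrite lef_pV2 ?posrE ?ltr0n ?addnS// ler_nat.
  by have := rden_gt0 (s ++ t); lia.
split; first by rewrite (le_trans IH1)// lerDl invr_ge0.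
apply: le_trans IH2; rewrite -addrA lerD2l rden_rcons natrM invfM.
move: D0 y2; rewrite -invr_gt0.
set x := _^-1; set y := _^-1.
by nra.
Qed.

Lemma rsum_cat_le s t :
  (rsum (s ++ t) : rat) <= rsum s + (rden s)%:R^-1.
Proof.
by apply: le_trans (rsum_cat s t).2; rewrite lerDl invr_ge0.
Qed.

Lemma rsum_rcons_lt s n t :
  (rsum s < rsum (rcons s n ++ t) :> rat) /\
  ((rsum (rcons s n ++ t) : rat) <= rsum s + 2 / (rden (rcons s n))%:R).
Proof.
have D0 : (0 : rat) < (rden (rcons s n))%:R^-1.
  by rewrite invr_gt0 ltr0n rden_gt0.
split.
  by apply: lt_le_trans (rsum_cat _ _).1; rewrite rsum_rcons ltrDl.
apply: le_trans (rsum_cat_le _ _) _.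
by rewrite rsum_rcons -addrA lerD2l mulr_natl mulr2n.
Qed.

(** A cluster point in [C] of the sums along [a] would be rational, yet it is approximated from
    below too fast relative to the denominators. *)
Lemma compact_rsum_branch (C : set rationals) (a : nat -> nat) :
  compact C -> ~ forall n, C (rsum (mkseq a n)).
Proof.
move=> Cc Ca.
have split_mkseq k n : (k < n)%N ->
    exists t, mkseq a n = rcons (mkseq a k) (a k) ++ t.
  move=> kn; exists (map a (iota k.+1 (n - k.+1))).
  by rewrite -mkseqS -map_cat -iotaD subnKC.
have [q [Cq clq]] := Cc ((fun n => rsum (mkseq a n)) @ \oo) _ (filterE _ Ca).
have qP k : rsum (mkseq a k) <= (q : rat) <=
    rsum (mkseq a k) + 2 / (rden (mkseq a k.+1))%:R.
  set l := rsum _; set r := (X in _ <= _ <= X).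
  have lrcl : closed ([set x : rat^o | l <= x] `&` [set x | x <= r]).
    by apply: closedI; [exact: closed_ge|exact: closed_le].
  suff [? ?] : ([set x : rat^o | l <= x] `&` [set x | x <= r]) q by apply/andP.
  apply: lrcl => V qV; apply: clq => //; exists k.+1 => // n /= kn.
  have [t ->] := split_mkseq k n kn.
  rewrite /= /l /r mkseqS.
  by have [/ltW ? ?] := rsum_rcons_lt (mkseq a k) (a k) t.
pose b := `|denq q|%N.
have b0 : (0 < b)%N by rewrite absz_gt0 denq_neq0.
(* This choice gives [D] > 2[b]. Multiplying the gap between [q] and the [k]-th sum by [D] and [b]
   gives a positive integer of size at most 2[b]/([D] + [a k] + 1) < 1. *)
pose k := (2 * b)%N; pose D := rden (mkseq a k).
have kD : (k < D)%N by have := rden_gt (mkseq a k); rewrite size_mkseq.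
have [m mE] := rsum_nat (mkseq a k).
pose x : int := numq q * D%:Z - m%:Z * b%:Z.
have D0 : (0 : rat) < D%:R by rewrite ltr0n rden_gt0.
have bq0 : (0 : rat) < b%:R by rewrite ltr0n.
have qb : (q : rat) * b%:R = (numq q)%:~R.
  rewrite -{1}(divq_num_den q) /b natr_absz gtr0_norm ?denq_gt0//.
  by rewrite divfK// intr_eq0 denq_neq0.
have xE : x%:~R = ((q : rat) - rsum (mkseq a k)) * (D%:R * b%:R).
  rewrite /x rmorphB !rmorphM /= -qb -!pmulrn -mE -/D.
  by ring.
have qz : 0 < (q : rat) - rsum (mkseq a k).
  rewrite subr_gt0; apply: lt_le_trans (andP (qP k.+1)).1.
  by rewrite mkseqS -[rcons _ _]cats0; have [] := rsum_rcons_lt (mkseq a k) (a k) [::].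
have x0 : 0 < x.
  by rewrite -(ltr0z rat) xE mulr_gt0// mulr_gt0.
have : x < 1.
  rewrite -(ltrz1 rat) xE.
  have /andP[_] := qP k; rewrite mkseqS rden_rcons -/D natrM invfM.
  rewrite -lerBlDl => qz2.
  apply: le_lt_trans (_ : 2 * b%:R / (D + (a k).+1)%:R < 1).
    have -> : 2 * b%:R / (D + (a k).+1)%:R =
        2 * (D%:R^-1 / (D + (a k).+1)%:R) * (D%:R * b%:R) :> rat.
      move: D0; generalize D (D + (a k).+1)%N => u v u0.

      by rewrite -[RHS]mulrA [X in _ = _ * X]mulrACA mulVf ?lt0r_neq0// mul1r
        [_^-1 * _]mulrC mulrA.
    by rewrite ler_wpM2r// ltW// mulr_gt0.
  rewrite ltr_pdivrMr ?ltr0n ?addnS// mul1r -natrM ltr_nat.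
  by move: kD; rewrite /k; lia.
by move: x0; lia.
Qed.

(** The subtrees of the children converge to [rsum s], so a filter not clustering there lives on
    finitely many of them. *)
Lemma compact_rsum_children (T : set (seq nat)) (s : seq nat) :
  (forall s t, T (s ++ t) -> T s) ->
  let B s := [set rsum (s ++ t) | t in [set t | T (s ++ t)]] in
  (forall n, compact (B (rcons s n))) -> compact (B s).
Proof.
move=> Tpre B Bc F FF FB.
have [_ [t0 Tt0 _]] := filter_ex FB.
have Ts : T s := Tpre _ _ Tt0.
have [zF|nzF] := pselect (cluster F (rsum s)).
  by exists (rsum s); split=> //; exists [::]; rewrite /= cats0.
have [X [V [FX sV XV]]] : exists X V, [/\ F X, nbhs (rsum s) V & X `&` V = set0].
  apply: contrapT => nXV; apply: nzF => X V FX sV.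
  by apply/set0P/eqP => XV; apply: nXV; exists X, V.
move: sV => /nbhs_ballP[e /= e0 eV].
(* Sums through a child [n] >= [N] exceed [rsum s] by at most 2/([N]+1), so they fall into the ball
   inside [V]. *)
pose N := Num.bound (2 / e).
have NE : 2 / N.+1%:R < e.
  rewrite ltr_pdivrMr// mulrC -ltr_pdivrMr//.
  apply: lt_trans (archi_boundP _) _; first by rewrite divr_ge0// ltW.
  by rewrite ltr_nat.
have cN : compact (\bigcup_(n < N) B (rcons s n)).
  by rewrite bigcup_mkord; apply: bigsetU_compact => n _; exact: Bc.
have sub : B s `&` X `<=` \bigcup_(n < N) B (rcons s n).
  move=> _ [[t Tt' <-] Xt]; have : ~ V (rsum (s ++ t)).
    by move=> Vt; rewrite -[False]/(set0 (rsum (s ++ t))) -XV.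
  case: t => [|n r] in Tt' Xt *.
    by rewrite cats0; case; apply: eV; exact: ballxx.
  rewrite -cat_rcons in Tt' Xt * => nV.
  exists n; last by exists r; rewrite /= ?cat_rcons.
  rewrite /= ltnNge; apply/negP => Nn; apply: nV; apply: eV.
  have [lt1 le1] := rsum_rcons_lt s n r.
  rewrite /ball /= distrC gtr0_norm ?subr_gt0// ltrBlDl.
  apply: le_lt_trans le1 _; rewrite ltrD2l; apply: le_lt_trans NE.
  rewrite ler_pM2l// lef_pV2 ?posrE ?ltr0n ?rden_gt0// ler_nat rden_rcons.
  by have := rden_gt0 s; nia.
have [p [Bp clp]] := cN F _ (filterS sub (filterI FB FX)).
exists p; split=> //; case: Bp => n _ [t' Tt' <-].
by exists (n :: t'); rewrite /= -?cat_rcons.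
Qed.

(** If the whole set were not compact, some child would again carry a non-compact set, and so on.
    The resulting branch never leaves [T], since the empty set is compact. *)
Lemma compact_rsum_tree (T : set (seq nat)) :
  (forall s t, T (s ++ t) -> T s) ->
  (forall a, ~ forall n, T (mkseq a n)) -> compact (rsum @` T).
Proof.
move=> Tpre Twf.
pose B s := [set rsum (s ++ t) | t in [set t | T (s ++ t)]].
rewrite -[rsum @` T]/(B [::]); apply: contrapT => nB0.
have step s : ~ compact (B s) -> exists n, ~ compact (B (rcons s n)).
  by move=> nB; apply/existsNP => Bc; apply: nB; exact: compact_rsum_children.
pose next s := if pselect (~ compact (B s)) is left h
  then projT1 (cid (step s h)) else 0%N.
have nextP s : ~ compact (B s) -> ~ compact (B (rcons s (next s))).
  rewrite /next => nB; case: pselect => // h.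
  exact: projT2 (cid (step s h)).
pose b := fix b n := if n is m.+1 then rcons (b m) (next (b m)) else [::].
pose a n := next (b n).
have bE n : b n = mkseq a n by elim: n => //= n IH; rewrite mkseqS -IH.
have nB n : ~ compact (B (b n)) by elim: n => //= n IH; exact: nextP.
apply: (Twf a) => n; apply: contrapT => nT; apply: (nB n).
suff -> : B (b n) = set0 by exact: compact0.
rewrite -subset0 => x [t Tt _]; apply: nT; rewrite -bE.
exact: Tpre Tt.
Qed.

(** * From co-analytic sets to the rationals *)

Lemma open_mdist_lt (R : realType) (Y : metricType R) (x : Y) (r : R) :
  open [set y | mdist x y < r].
Proof.
rewrite openE => y /= xy; apply/nbhs_ballP.
exists (r - mdist x y); first by rewrite /= subr_gt0.
move=> z; rewrite ballEmdist /= ltrBrDl.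
exact: le_lt_trans (metric_triangle _ y _).
Qed.

(** * A Souslin scheme for the range of a continuous map on a complete separable space *)

Section analytic_scheme.
Variables (R : realType) (K Y : metricType R) (f : Y -> K).
Hypotheses (Ycomplete : complete_metric Y) (Ysep : separable Y).
Hypothesis cf : continuous f.

Variables (D : set Y) (c : Y -> nat).
Hypotheses (Ddense : dense D) (c_inj : {in D &, injective c}).

Definition dense_ball i k (p : Y) :=
  exists d, [/\ D d, c d = i & mdist d p < k.+1%:R^-1].

Definition scheme (s : seq nat) (p : Y) :=
  forall k, (k < size s)%N -> dense_ball (nth 0%N s k) k p.

Definition scheme_nbhd (s : seq nat) (x : K) :=
  exists2 p, scheme s p & mdist (f p) x < (size s).+1%:R^-1.

Lemma scheme_nbhd_cat s t x : scheme_nbhd (s ++ t) x -> scheme_nbhd s x.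
Proof.
move=> [p Pp px]; exists p.
  move=> k ks; have := Pp k; rewrite size_cat nth_cat ks; apply.
  exact: ltn_addr.
apply: lt_le_trans px _; rewrite lef_pV2 ?posrE// ler_nat ltnS size_cat.
exact: leq_addr.
Qed.

Lemma scheme_nbhd_open s : open (scheme_nbhd s).
Proof.
rewrite [scheme_nbhd s](_ : _ = \bigcup_(p in scheme s)
    [set x | mdist (f p) x < (size s).+1%:R^-1]).
  by apply: bigcup_open => p _; exact: open_mdist_lt.
by apply/seteqP; split=> x [p]; exists p.
Qed.

Lemma scheme_nbhd_branch p : exists a, forall n, scheme_nbhd (mkseq a n) (f p).
Proof.
have ex k : exists i, dense_ball i k p.
  have k0 : (0 : R) < k.+1%:R^-1 by rewrite invr_gt0.
  have [|d /= [pd Dd]] := Ddense _ (open_mdist_lt p k.+1%:R^-1).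
    by exists p; rewrite /= mdistxx.
  by exists (c d), d; rewrite metric_sym.
have /choice[a aP] := ex; exists a => n; exists p; last by rewrite mdistxx invr_gt0.
by move=> k; rewrite size_mkseq => kn; rewrite nth_mkseq.
Qed.

Lemma scheme_branch_dist a k p q :
  scheme (mkseq a k.+1) p -> scheme (mkseq a k.+1) q ->
  mdist p q < 2 / k.+1%:R.
Proof.
move=> /(_ k) + /(_ k); rewrite size_mkseq nth_mkseq// => /(_ (ltnSn k)).
move=> [d [Dd da dp]] /(_ (ltnSn k)) [d' [Dd' d'a d'q]].
have dd' : d = d' by apply: c_inj; rewrite ?inE// da.
rewrite -dd' in d'q; apply: le_lt_trans (metric_triangle _ d _) _.
by rewrite metric_sym mulr_natl mulr2n ltrD.
Qed.

(** Points chosen in the pieces along [a] form a Cauchy sequence, whose limit is sent to [x] by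
    continuity. Closures are allowed because the compactness argument for a tree only yields a
    cluster point. *)
Lemma closure_scheme_branch a x :
  (forall n, closure (scheme_nbhd (mkseq a n)) x) -> range f x.
Proof.
move=> Ux.
have small (e : R) : 0 < e -> exists k, 2 / k.+1%:R < e.
  move=> e0; have [k] := ltr_add_invr (divr_gt0 e0 (ltr0n R 2)).
  by rewrite add0r => ke; exists k; rewrite mulrC -ltr_pdivlMr.
have ex n : exists p, scheme (mkseq a n) p.
  by have [_ [[p Pp _] _]] := Ux n _ filterT; exists p.
have /choice[y yP] := ex.
have yS k : (y @ \oo) (scheme (mkseq a k)).
  exists k => // n /= kn j; rewrite size_mkseq => jk.
  have := yP n j; rewrite size_mkseq !nth_mkseq ?(leq_trans jk)//; exact.
have ycauchy : cauchy (y @ \oo).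
  move=> E; rewrite -entourage_ballE => -[e /= e0 eE].
  have [k ke] := small e e0.
  exists (scheme (mkseq a k.+1), scheme (mkseq a k.+1)).
    by split; exact: yS.
  move=> [p q] /= [Pp Pq].
  apply: eE; rewrite /= ballEmdist /=.
  exact: lt_trans (scheme_branch_dist Pp Pq) ke.
have [p yp] := Ycomplete (fmap_proper_filter _ _) ycauchy.
exists p => //; apply/esym/mdist_positivity/eqP; apply: contrapT => /negP.
rewrite eq_sym; set e := mdist _ _ => ne.
have e0 : 0 < e by rewrite lt_neqAle ne mdist_ge0.
(* One third each for the steps from [f p] to [f q], from [f q] to [x'], and from [x'] to [x]. *)
have e3 : 0 < e / 3 by rewrite divr_gt0.
have /nbhs_ballP[d /= d0 dfp] : \forall q \near p, ball (f p) (e / 3) (f q).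
  by apply: cf; exact: nbhsx_ballx.
have d2 : 0 < d / 2 by rewrite divr_gt0.
(* Deep enough that the piece has diameter below [d / 2] and that the neighbourhood of its image has
   radius below [e / 3]. *)
have [k] : exists k, 2 / k.+1%:R < Num.min (d / 2) (e / 3).
  by apply: small; rewrite lt_min d2.
rewrite lt_min => /andP[kd ke].
have [x' [[q Pq qx'] xx']] := Ux k.+1 _ (nbhsx_ballx x _ e3).
have [q' [Pq' pq']] : scheme (mkseq a k.+1) `&` ball p (d / 2) !=set0.
  apply: (@filter_ex _ (y @ \oo)); apply: filterI (yS _) _.
  by apply: yp; exact: nbhsx_ballx.
have pq : mdist p q < d.
  rewrite ballEmdist /= in pq'.
  apply: le_lt_trans (metric_triangle _ q' _) _.
  by rewrite (splitr d) ltrD// (lt_trans (scheme_branch_dist Pq' Pq)).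
have : mdist (f p) (f q) < e / 3.
  by have := dfp q; rewrite !ballEmdist; exact.
move: xx'; rewrite ballEmdist /= metric_sym => x'x.
have k1 : (k.+2%:R^-1 : R) <= 2 / k.+1%:R.
  rewrite -[leLHS]mul1r ler_pM ?ler1n// lef_pV2 ?posrE// ler_nat//.
rewrite size_mkseq in qx'.
have qx'e := lt_trans (lt_le_trans qx' k1) ke.
have := metric_triangle (f p) (f q) x; have := metric_triangle (f q) x' x.
have : e = mdist (f p) x by rewrite /e metric_sym.
by lra.
Qed.

End analytic_scheme.

Lemma homeomorphic_separable (X Y : topologicalType) :
  homeomorphic X Y -> separable X -> separable Y.
Proof.
move=> [f [g [fK gK cf cg]]] [D Dc Dd]; exists (f @` D).
  exact: card_le_trans (card_image_le _ _) Dc.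
move=> U [y Uy] oU.
have [|x [Ux Dx]] := Dd (f @^-1` U) _ (open_comp (in1W cf) oU).
  by exists (g y); rewrite /= gK.
by exists (f x); split=> //; exists x.
Qed.

Lemma tukey_ge_rationals_coanalytic (R : realType) (K Y : metricType R)
    (f : Y -> K) :
  compact [set: K] -> complete_metric Y -> separable Y -> continuous f ->
  tukey_ge (Kc rationals) (Kc (~` range f)).
Proof.
move=> Kcpt Yc [D /countable_injP[c c_inj] Dd] cf.
pose U := scheme_nbhd f D c.
pose H (C : set rationals) := [set x | forall s, U s x -> C (rsum s)].
have Hcl C : closed (H C).
  rewrite [H C](_ : _ = \bigcap_(s in [set s | ~ C (rsum s)]) ~` U s).
    apply: closed_bigI => s _; apply: open_closedC.
    exact: scheme_nbhd_open.
  apply/seteqP; split=> x xH s; first by move=> ns /xH.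
  by move=> sx; apply: contrapT => ns; exact: (xH s).
have Hcpt C : compact (H C) by exact: subclosed_compact (Hcl C) Kcpt _.
have Hsub C : compact C -> H C `<=` ~` range f.
  move=> Cc _ /[swap] -[p _ <-] pH.
  have [a aU] := scheme_nbhd_branch f c Dd p.
  by apply: (compact_rsum_branch (a := a) Cc) => n; exact/pH/aU.
pose phi (C : Kc rationals) : Kc (~` range f) :=
  exist _ _ (compact_set_type (Hcpt _) (Hsub _ (svalP C))).
apply: (@tukey_ge_monotone _ _ phi) => [C C' CC' x xC s sx|[L Lc]].
  exact/CC'/xC.
(* This tree is well-founded: along an infinite branch, a cluster point in [L] would lie in the
   closure of every [U], hence in the range of [f]. *)
pose T := [set s | exists2 x, L x & U s (set_val x)].
have Tcpt : compact (rsum @` T).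
  apply: compact_rsum_tree => [s t [x Lx stx]|a aT].
    by exists x => //; exact: scheme_nbhd_cat stx.
  have /choice[x xP] : forall n, exists x, L x /\ U (mkseq a n) (set_val x).
    by move=> n; have [x] := aT n; exists x.
  have [y [Ly cly]] := Lc (x @ \oo) _ (filterE _ (fun n => (xP n).1)).
  have : (~` range f) (set_val y) by exact: set_valP.
  apply; apply: (closure_scheme_branch Yc cf c_inj (a := a)) => n V yV.
  have yV' : nbhs y (set_val @^-1` V) by apply/nbhs_set_typeP; exists V.
  have xU : (x @ \oo) (set_val @^-1` U (mkseq a n)).
    exists n => // m /= nm; have [_] := xP m.
    by rewrite -{1}(subnKC nm) /mkseq iotaD map_cat; exact: scheme_nbhd_cat.
  have [z [zU zV]] := cly _ _ xU yV'.
  by exists (set_val z).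
exists (exist _ _ Tcpt) => x Lx /=.
by move=> s sx; exists s => //; exists x.
Qed.

Lemma tukey_ge_rationals (R : realType) (X : topologicalType) :
  coanalytic R X -> tukey_ge (Kc rationals) (Kc X).
Proof.
move=> [_ [K [A [Kcpt [_ [P [f [[Psep [Y Yc PY]] cf fT]]]] XA]]]].
have Ysep := homeomorphic_separable PY Psep.
have [p [g [pK gK cp cg]]] := PY.
apply: tukey_ge_trans (tukey_ge_compact_covering
  (homeomorphic_compact_covering_image XA)).
have AE : range (set_val \o f \o g) = A.
  apply/seteqP; split=> [_ [y _ <-]|x Ax]; first exact: set_valP.
  have [q _ qx] : range f (exist _ x (mem_set Ax)) by rewrite fT.
  by exists (p q) => //=; rewrite pK qx.
rewrite -{1}AE; apply: (tukey_ge_rationals_coanalytic Kcpt Yc Ysep) => y.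
apply: continuous_comp; first exact: cg.
apply: continuous_comp; first exact: cf.
exact: initial_continuous.
Qed.

(** * From the rationals to co-analytic sets *)

(** The exponents of 2 in n^2 and 2 d^2 have different parities. This makes the balls of irrational
    radius below clopen. *)
Lemma sqr_rat_neq2 (x : rat) : x ^+ 2 != 2.
Proof.
apply/eqP => x2.
pose n := `|numq x|%N; pose d := `|denq x|%N.
have d0 : (0 < d)%N by rewrite absz_gt0 denq_neq0.
have nd : (n ^ 2 = 2 * d ^ 2)%N.
  have : numq x ^+ 2 = 2 * denq x ^+ 2.
    by apply: (@intr_inj rat); rewrite !expr2 !intrM numqE mulrACA -expr2 x2.
  by move/(congr1 absz); rewrite abszM !abszX.
have n0 : (0 < n)%N by rewrite -sqrn_gt0 nd muln_gt0 expn_gt0 d0.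
have := congr1 (logn 2) nd.
by rewrite lognM ?expn_gt0 ?d0// !lognX (pfactorK 1)//; lia.
Qed.

(* The balls with rational centre [p.1] and irrational radius
   [sqrt 2 / (p.2 + 1)] form a clopen base of the rationals. *)
Definition ratcode (R : realType) (q : rationals) : fsp R (rat * nat)%type bool :=
  fun p => ((q : rat) - p.1) ^+ 2 * p.2.+1%:R ^+ 2 < 2.

Lemma continuous_ratcode (R : realType) : continuous (@ratcode R).
Proof.
apply: continuous_fsp => p q.
pose g (x : rat^o) : rat^o := (x - p.1) * (x - p.1) * p.2.+1%:R ^+ 2.
have gE x : ratcode R x p = (g x < 2) by rewrite /ratcode expr2.
have cg : {for q, continuous g}.
  have cB : (x - p.1 : rat^o) @[x --> (q : rat^o)] --> (q - p.1 : rat^o).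
    by apply: cvgB; [exact: cvg_id|exact: cvg_cst].
  by apply: cvgM; [exact: cvgM|exact: cvg_cst].
(* No rational lies on the boundary, so membership and non-membership are both open. *)
have g2 x : g x != 2 by rewrite /g -expr2 -exprMn; exact: sqr_rat_neq2.
have [lt2|gt2|/eqP] := ltgtP (g q) 2; last by rewrite (negbTE (g2 _)).
- have : nbhs q [set x | g x < 2] by exact: (cvgr_lt _ cg _ lt2).
  by apply: filterS => x gx; rewrite !gE gx lt2.
- have : nbhs q [set x | 2 < g x] by exact: (cvgr_gt _ cg _ gt2).
  by apply: filterS => x gx; rewrite !gE !ltNge !ltW.
Qed.

Lemma ratcode_nbhs (R : realType) (q : rationals) (V : set rationals) :
  nbhs q V -> exists p, ratcode R q p /\
    forall q', ratcode R q' p -> V q'.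
Proof.
move=> /nbhs_ballP[e /= e0 eV].
pose N := Num.bound (2 / e).
have NE : 2 / N.+1%:R < e.
  rewrite ltr_pdivrMr// mulrC -ltr_pdivrMr//.
  apply: lt_trans (archi_boundP _) _; first by rewrite divr_ge0// ltW.
  by rewrite ltr_nat.
exists (q, N); split=> [|q']; rewrite /ratcode /=.
  by rewrite subrr expr0n mul0r.
rewrite -exprMn => q'2; apply: eV; rewrite /ball /= distrC.
apply: le_lt_trans NE; rewrite ler_pdivlMr// ltW//.
rewrite -[N.+1%:R]normr_nat -normrM ltNge; apply/negP => ge2.
suff : (2 : rat) ^+ 2 <= 2 by [].
rewrite (le_trans _ (ltW q'2))// -[leRHS]real_normK ?num_real//.
by rewrite lerXn2r// nnegrE.
Qed.

Lemma continuous_set_type (X Y : topologicalType) (A : set Y) (f : X -> A) :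
  continuous (set_val \o f) -> continuous f.
Proof.
move=> cf x U /nbhs_set_typeP[V Vfx VU].
apply: (@filterS _ (nbhs x) _ ((set_val \o f) @^-1` V)) => [y|]; first exact: VU.
exact: cf.
Qed.

(** * Coding pairs of a compact set of rationals and a point of [M] *)

Section coding.
Variables (R : realType) (M : topologicalType) (W : nat -> set M).
Hypothesis M_hausdorff : hausdorff_space M.
Hypothesis W_base : forall (x : M) V, nbhs x V ->
  exists2 i, W i x & closure (W i) `<=` V.
Hypothesis W_open : forall i, open (W i).

Local Notation J := (rat * nat)%type.
(** The left summand of an index names a cylinder, for the compact set; the right one names a member
    of the base, for the point. *)
Local Notation I := (seq (J * bool) + nat)%type.
Local Notation H := (fsp R I bool).
Local Notation u := (@ratcode R).

Variable D : set rationals -> set M.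
Hypothesis D_compact : forall C, compact C -> compact (D C).
Hypothesis D_mono : forall C C', C `<=` C' -> D C `<=` D C'.
Hypothesis D_cofinal : forall L, compact L -> exists2 C, compact C & L `<=` D C.

(* A code for [x] must accept [i] when [x] is in [W i] and reject [i] when [x]
   is outside its closure; leaving the boundary free makes the set of pairs
   (code, point) closed. *)
Definition codes_point (h : H) (x : M) :=
  forall i, if h (inr i) then closure (W i) x else ~ W i x.

Lemma codes_point_inj h x y : codes_point h x -> codes_point h y -> x = y.
Proof.
move=> hx hy; apply: contrapT => xy.
have [V [oV /set_mem xV /set_mem]] :=
  hausdorff_accessible M_hausdorff (introN eqP xy); apply.
have [i Wx WV] := W_base (open_nbhs_nbhs (conj oV xV)).
by apply: WV; move: (hx i) (hy i); case: ifP.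
Qed.

(** Any cluster point in [L] of the coded points works: each bit of [k] is eventually that of [h n],
    and both alternatives in [codes_point] are closed conditions on the point. *)
Lemma codes_point_limit (L : set M) (h : nat -> H) (k : H) :
  compact L -> (forall n, agree n k (h n)) ->
  (forall n, exists2 x, L x & codes_point (h n) x) ->
  exists2 x, L x & codes_point k x.
Proof.
move=> Lc kh hL.
have /choice[x xP] : forall n, exists x, L x /\ codes_point (h n) x.
  by move=> n; have [x] := hL n; exists x.
have [y [Ly cly]] := Lc (x @ \oo) _ (filterE _ (fun n => (xP n).1)).
exists y => // i.
have xi : (x @ \oo) [set z | if k (inr i) then closure (W i) z else ~ W i z].
  exists (pickle (inr i : I)).+1 => // n /= ni; rewrite (kh n)//.
  exact: (xP n).2.
case: (k (inr i)) xi => xi.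
  apply: closed_closure => V yV; exact: cly.
move=> Wy; have [z [nWz Wz]] := cly _ _ xi (open_nbhs_nbhs (conj (W_open i) Wy)).
exact: nWz.
Qed.

Definition codes_compact (h : H) (C : set rationals) :=
  forall l, h (inl l) <-> exists2 c, C c & cyl l (u c).

Definition coded (h : H) := exists C,
  [/\ compact C, codes_compact h C & exists2 x, D C x & codes_point h x].

(** If [h] codes a compact [C], the branches are exactly the images under [u] of the points of [C],
    as that image is closed. *)
Definition branch (h : H) (z : fsp R J bool) := forall l, cyl l z -> h (inl l).

Definition code_space :=
  closure coded `&` [set h | forall z, branch h z -> exists q, z = u q].

Lemma coded_code_space : coded `<=` code_space.
Proof.
move=> h [C [Cc hC hx]]; split; first by apply: subset_closure; exists C.
move=> z hz.
have uC : closed (u @` C).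
  apply: compact_closed; first exact: metric_hausdorff.
  apply: continuous_compact => //; apply: continuous_subspaceT.
  exact: continuous_ratcode.
suff [q _ <-] : (u @` C) z by exists q.
apply: uC => V /nbhs_fspP[n nV].
have [l lz ln] := cyl_agree n z.
have [c Cc' lc] := (hC l).1 (hz l lz).
by exists (u c); split; [exists c|exact/nV/ln].
Qed.

(** [u] is an embedding into a compact space, so closed sets inside its range pull back to compact
    sets. *)
Lemma compact_ratcode (E : set (fsp R J bool)) :
  closed E -> E `<=` range u -> compact (u @^-1` E).
Proof.
move=> Ecl Eu F FF FE.
have Ec : compact E by exact: subclosed_compact Ecl (@compact_fsp_bool R J) _.
have [_ [/[dup] /Eu[q _ <-] Eq clq]] := Ec (u @ F) _ FE.
exists q; split=> // X V FX qV.
have [j [qj jV]] := ratcode_nbhs R qV.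
have FX' : (u @ F) (u @` X) by apply: (@filterS _ F _ X) => // x Xx; exists x.
have [_ [[x Xx <-] xj]] := clq _ _ FX' (nbhs_coord j (u q)).
by exists x; split=> //; apply: jV; rewrite xj.
Qed.

Lemma code_space_codes_point h : code_space h -> exists x, codes_point h x.
Proof.
move=> [/closure_fsp[k kP] hu].
have /choice[C CP] : forall n, exists C, [/\ compact C, codes_compact (k n) C &
    exists2 x, D C x & codes_point (k n) x] by move=> n; exact: (kP n).1.
have uC n : compact (u @` C n).
  apply: continuous_compact; last by have [] := CP n.
  by apply: continuous_subspaceT; exact: continuous_ratcode.
(* Pulled back along [u], this becomes one compact set containing every [C n]; its value under [D]
   then contains all the coded points. *)
pose E := branch h `|` \bigcup_n (u @` C n).
have Eu : E `<=` range u.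
  by move=> z [/hu[q ->]|[n _ [q _ <-]]]; exists q.
have Ecl : closed E.
  apply: closed_fsp => z /not_orP[nhz nCz].
  have /existsNP[l /not_implyP[lz /negP hl]] := nhz.
  (* From [N] on, [k n] agrees with [h] in rejecting the cylinder [l], so it misses the image of
     [C n]; only finitely many closed sets remain to be avoided. *)
  pose N := (pickle (inl l : I)).+1.
  have clN : closed (\bigcup_(n < N) (u @` C n)).
    apply: compact_closed; first exact: metric_hausdorff.
    by rewrite bigcup_mkord; apply: bigsetU_compact.
  have nN : nbhs z (~` (\bigcup_(n < N) (u @` C n))).
    apply: open_nbhs_nbhs; split; first exact: closed_openC.
    by move=> [n _ Cnz]; apply: nCz; exists n.
  apply: filterS2 nN (nbhs_cyl lz) => y nNy ly [/(_ l ly)|[n _ Cny]].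
    by rewrite (negbTE hl).
  have [nN'|Nn] := ltnP n N; first by apply: nNy; exists n.
  have [_ covC _] := CP n; case: Cny => c Cc cy.
  move: hl; rewrite ((kP n).2 (inl l) Nn) => /negP; apply.
  by apply/covC; exists c => //; rewrite cy.
have := compact_ratcode Ecl Eu; set B := _ @^-1` _ => Bc.
have [|x _ hx] := codes_point_limit (D_compact Bc) (fun n => (kP n).2) _.
  move=> n; have [_ _ [x Dx kx]] := CP n; exists x => //.
  by apply: D_mono Dx => c Cc; right; exists n => //; exists c.
by exists x.
Qed.

Lemma closed_codes (C : set rationals) (L : set M) :
  compact L -> closed [set h | codes_compact h C /\ exists2 x, L x & codes_point h x].
Proof.
move=> Lc h /closure_fsp[k kP]; split; last first.
  exact: codes_point_limit Lc (fun n => (kP n).2) (fun n => (kP n).1.2).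
move=> l; have [[/(_ l) kC _] kh] := kP (pickle (inl l : I)).+1.
by rewrite (kh (inl l)).
Qed.

Lemma exists_code (C : set rationals) (x : M) :
  exists h, codes_compact h C /\ codes_point h x.
Proof.
exists (fun i => match i with
  | inl l => `[< exists2 c, C c & cyl l (u c) >]
  | inr i => `[< W i x >]
  end); split=> [l|i]; first by split=> /asboolP.
by case: asboolP => // Wx; exact: subset_closure.
Qed.

(** The double complement is the form in which [coanalytic] presents a space. *)
Lemma code_space_compact_covering_image :
  compact_covering_image (~` (~` code_space)) M.
Proof.
have ex (h : ~` (~` code_space)) : exists x, codes_point (set_val h) x.
  by apply: code_space_codes_point; apply: contrapT; exact: (set_valP h).
pose f h := projT1 (cid (ex h)).
have fP h : codes_point (set_val h) (f h) by exact: projT2 (cid (ex h)).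
exists f; split=> [h V|L Lc].
  (* A single bit gives continuity: it is true at [h] because [f h] is in [W i], and where it is
     true the decoded point lies in the closure of [W i]. *)
  move=> /W_base[i Wi WV]; apply/nbhs_set_typeP.
  exists [set k | k (inr i) = set_val h (inr i)]; first exact: nbhs_coord.
  move=> k /= ki; apply: WV; have := fP k i; rewrite ki.
  by move: (fP h i); case: ifP.
have [C Cc LC] := D_cofinal Lc.
pose Z := [set h | codes_compact h C /\ exists2 x, L x & codes_point h x].
have Zc : compact Z.
  by apply: subclosed_compact (@compact_fsp_bool R I) _ => //; exact: closed_codes.
have Zcode : Z `<=` ~` (~` code_space).
  rewrite setCK => h [hC [x Lx hx]]; apply: coded_code_space.
  by exists C; split=> //; exists x => //; exact: LC.
exists (set_val @^-1` Z); first exact: compact_set_type.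
move=> x Lx; have [h [hC hx]] := exists_code C x.
have Zh : Z h by split=> //; exists x.
exists (exist _ h (mem_set (Zcode _ Zh))) => //.
by apply: codes_point_inj (fP _) _.
Qed.

(** * The complement of the code space as a continuous image of a Polish space *)

(* A witness that [h] is outside the code space is a branch [z] differing from
   every [u q] (coordinate [Some q] bounds the first difference), or, when
   coordinate [None] is [m.+1], the failure of every coded point to agree with
   [h] up to [m]. *)
Local Notation Wit := (fsp R (I + J + option rat)%type nat).

Definition wit_code (g : Wit) : H := fun i => g (inl (inl i)) != 0%N.

Definition wit_branch (g : Wit) : fsp R J bool :=
  fun j => g (inl (inr j)) != 0%N.

Definition witness : set Wit := fun g =>
  if g (inr None) is m.+1 then
    forall k, coded k -> ~ agree m (wit_code g) k
  else branch (wit_code g) (wit_branch g) /\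
    forall q : rat, ~ agree (g (inr (Some q))) (wit_branch g) (u q).

Lemma continuous_wit_code : continuous wit_code.
Proof.
apply: continuous_fsp => i g.
by apply: filterS (nbhs_coord (inl (inl i)) g) => g' gg'; rewrite /wit_code gg'.
Qed.

Lemma continuous_wit_branch : continuous wit_branch.
Proof.
apply: continuous_fsp => j g.
by apply: filterS (nbhs_coord (inl (inr j)) g) => g' gg'; rewrite /wit_branch gg'.
Qed.

(** Once coordinate [None] is fixed, membership is a conjunction of conditions that each depend on
    finitely many coordinates, so any failure persists nearby. *)
Lemma closed_witness : closed witness.
Proof.
apply: closed_fsp => g; rewrite {1}/witness.
have := nbhs_coord (inr None) g; case: (g (inr None)) => [|m] g0.
  move=> /not_andP[/existsNP[l /not_implyP[lz hl]]|/existsNP[q /contrapT zq]].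
    have lg := continuous_wit_branch (nbhs_cyl lz).
    have hg := continuous_wit_code (nbhs_coord (inl l) (wit_code g)).
    apply: filterS3 g0 lg hg => g' g'0 lg' hg'.
    rewrite /witness g'0 => -[/(_ l lg')] .
    by rewrite hg'.
  have zg := continuous_wit_branch (nbhs_agree (g (inr (Some q))) (wit_branch g)).
  have qg := nbhs_coord (inr (Some q)) g.
  apply: filterS3 g0 zg qg => g' g'0 zg' qg'.
  rewrite /witness g'0 => -[_ /(_ q)]; apply; rewrite qg' => j jn.
  by rewrite -zg'// zq.
move=> /existsNP[k /not_implyP[ck /contrapT gk]].
have hg := continuous_wit_code (nbhs_agree m (wit_code g)).
apply: filterS2 g0 hg => g' g'0 hg'.
rewrite /witness g'0 => /(_ k ck); apply=> i im.
by rewrite -hg'// gk.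
Qed.

Lemma witness_code_space : wit_code @` witness = ~` code_space.
Proof.
apply/seteqP; split=> [_ [g + <-]|h].
  rewrite /witness; case: (g (inr None)) => [[bz zq] [_ hu]|m gm [ch _]].
    by have [q zE] := hu _ bz; apply: (zq q) => j _; rewrite zE.
  have [k [ck gk]] := ch _ (nbhs_agree m (wit_code g)).
  exact: gm gk.
move=> /not_andP[nh|/existsNP[z /not_implyP[hz nz]]].
  have [m hm] : exists m, forall k, coded k -> ~ agree m h k.
    apply: contrapT => nm; apply: nh => V /nbhs_fspP[n nV].
    apply: contrapT => nk; apply: nm; exists n => k ck hk.
    by apply: nk; exists k; split=> //; exact: nV.
  pose g : Wit := fun i => match i with
    | inl (inl i) => h i : nat | inr None => m.+1 | _ => 0%N end.
  have gh : wit_code g = h by apply/funext => i; rewrite /wit_code /=; case: (h i).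
  by exists g => //; rewrite /witness /= gh.
have /choice[n nP] : forall q : rat, exists n, ~ agree n z (u q).
  move=> q; apply: contrapT => nq; apply: nz; exists q; apply/funext => j.
  apply: contrapT => zj; apply: nq; exists (pickle j).+1 => zq.
  by apply: zj; exact: zq.
pose g : Wit := fun i => match i with
  | inl (inl i) => h i : nat | inl (inr j) => z j : nat
  | inr (Some q) => n q | inr None => 0%N end.
have gh : wit_code g = h by apply/funext => i; rewrite /wit_code /=; case: (h i).
have gz : wit_branch g = z by apply/funext => i; rewrite /wit_branch /=; case: (z i).
by exists g => //; rewrite /witness /= gh gz.
Qed.

Lemma separable_metrizable_fsp (K : countType) (T : countType)
  (A : set (fsp R K T)) : separable_metrizable R A.
Proof.
split; first exact: separable_fsp.
exists (A : metricType R); exact: homeomorphic_refl.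
Qed.

Lemma analytic_code_spaceC : analytic R (~` code_space).
Proof.
split; first exact: separable_metrizable_fsp.
have gA (g : witness) : wit_code (set_val g) \in ~` code_space.
  by rewrite inE -witness_code_space; exists (set_val g) => //; exact: set_valP.
pose f (g : witness) : ~` code_space :=
  exist (fun h => h \in ~` code_space) _ (gA g).
exists (witness : topologicalType), f; split.
- split; first exact: separable_fsp.
  exists (witness : metricType R); last exact: homeomorphic_refl.
  exact: complete_closed_fsp closed_witness.
- apply: continuous_set_type => g.
  rewrite -[set_val \o f]/(wit_code \o set_val).
  apply: continuous_comp; first exact: initial_continuous.
  exact: continuous_wit_code.
- apply/seteqP; split=> // h _.
  have : (~` code_space) (set_val h) by exact: set_valP.
  rewrite -{1}witness_code_space => -[g gw gh].
  by exists (exist _ g (mem_set gw)) => //; exact: val_inj.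
Qed.

Lemma coanalytic_code_space : coanalytic R (~` (~` code_space)).
Proof.
split; first exact: separable_metrizable_fsp.
exists (H : metricType R), (~` code_space); split.
- exact: compact_fsp_bool.
- exact: analytic_code_spaceC.
- exact: homeomorphic_refl.
Qed.

End coding.

(** * Supplying the base and the monotone map for the coding *)

Lemma metrizable_base (R : realType) (M : topologicalType) :
  separable_metrizable R M -> exists W : nat -> set M,
    (forall i, open (W i)) /\ forall x V, nbhs x V ->
    exists2 i, W i x & closure (W i) `<=` V.
Proof.
move=> [[D /countable_injP[c c_inj] Dd] [Y [f [g [fK _ cf cg]]]]].
pose B i k := [set x | exists d, [/\ D d, c d = i &
  mdist (f d) (f x) < (k.+1%:R^-1 : R)]].
have oball y (r : R) : open [set x | mdist y (f x) < r].
  by apply: (open_comp (in1W cf) (open_mdist_lt y r)).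
exists (fun n => if unpickle n is Some (i, k) then B i k else set0); split=> [n|].
  case: unpickle => [[i k]|]; last exact: open0.
  rewrite [B i k](_ : _ = \bigcup_(d in D `&` [set d | c d = i])
      [set x | mdist (f d) (f x) < (k.+1%:R^-1 : R)]).
    by apply: bigcup_open => d _; exact: oball.
  by apply/seteqP; split=> x [d]; [move=> [Dd' di dx]; exists d|
    move=> [Dd' di] dx; exists d].
move=> x V xV.
have /nbhs_ballP[e /= e0 eV] : nbhs (f x) (g @^-1` V) by apply: cg; rewrite fK.
(* A radius below [e / 3] covers the three steps from [x] to the centre [d], to a ball point [w]
   near [y], and to [y] itself. *)
have [k] := ltr_add_invr (divr_gt0 e0 (ltr0n R 3)); rewrite add0r => ke.
have [|d [xd Dd']] := Dd _ _ (oball (f x) k.+1%:R^-1).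
  by exists x; rewrite /= mdistxx invr_gt0.
exists (pickle (c d, k)); rewrite pickleK.
  by exists d; split=> //; rewrite metric_sym.
move=> y yB.
have [|w [[d' [Dd'' cd' d'w]] /= yw]] := yB [set w | mdist (f y) (f w) < k.+1%:R^-1].
  by apply: open_nbhs_nbhs; split; [exact: oball|rewrite /= mdistxx invr_gt0].
have dd' : d' = d by apply: c_inj; rewrite ?inE.
rewrite -(fK y); apply: eV; rewrite ballEmdist /=; rewrite dd' in d'w.
have := metric_triangle (f x) (f d) (f y).
have := metric_triangle (f d) (f w) (f y).
move: ke d'w xd yw; rewrite [mdist (f w) (f y)]metric_sym /=.
set t := _%:R^-1; move: (mdist _ _) (mdist _ _) (mdist _ _) (mdist _ _) => a b c' d0.
by lra.
Qed.

Lemma metrizable_hausdorff (R : realType) (M : topologicalType) :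
  metrizable R M -> hausdorff_space M.
Proof.
move=> [Y [f [g [fK _ cf cg]]]] x y xy; apply: (can_inj fK).
apply: metric_hausdorff => U V fxU fyV.
have [z [zU zV]] := xy _ _ (cf x _ fxU) (cf y _ fyV).
by exists (f z).
Qed.

(* Intersecting the values above [C] turns a Tukey quotient into a monotone
   map with cofinal image. *)
Lemma tukey_ge_Kc_monotone (Q M : topologicalType) :
  hausdorff_space M -> tukey_ge (Kc Q) (Kc M) ->
  exists D : set Q -> set M,
    [/\ forall C, compact C -> compact (D C),
        forall C C', C `<=` C' -> D C `<=` D C' &
        forall L, compact L -> exists2 C, compact C & L `<=` D C].
Proof.
move=> Mh [phi phiP].
pose D (C : set Q) := \bigcap_(C' in [set C' : Kc Q | C `<=` sval C'])
  sval (phi C').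
exists D; split=> [C Cc|C C' CC'|L Lc].
- apply: (@subclosed_compact _ _ (sval (phi (exist _ C Cc)))).
  + apply: closed_bigI => C' _; apply: compact_closed => //.
    exact: svalP (phi C').
  + exact: svalP (phi _).
  + by move=> x; apply.
- by move=> x xD C'' C'C''; apply: xD; exact: subset_trans C'C''.
apply: contrapT => nC.
(* If no value of [D] contained [L], every compact set would lie below a member of [S]; then [phi]
   would send a member of [S] above [L], a contradiction. *)
pose S := [set C : Kc Q | ~ L `<=` sval (phi C)].
have /phiP/(_ (exist _ L Lc))[_ [C SC <-] //] : cofinal S.
move=> C; apply: contrapT => nS; apply: nC; exists (sval C); first exact: svalP.
move=> x Lx C' CC'; apply: contrapT => nx; apply: nS.
by exists C' => // /(_ x Lx).
Qed.

Theorem theorem43 (R : realType) (M : topologicalType)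
    (hM : separable_metrizable R M) :
  tukey_ge (Kc rationals) (Kc M) <->
  exists2 X : topologicalType, coanalytic R X & compact_covering_image X M.
Proof.
split=> [|[X Xco XM]]; last first.
  apply: tukey_ge_trans (tukey_ge_compact_covering XM).
  exact: tukey_ge_rationals Xco.
have Mh := metrizable_hausdorff hM.2.
have [W [oW Wbase]] := metrizable_base hM.
move=> /(tukey_ge_Kc_monotone Mh)[D [Dc Dmono Dcof]].
exists (~` (~` code_space (R := R) W D)).
  exact: coanalytic_code_space.
exact: code_space_compact_covering_image.
Qed.
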